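(* Let $\epsilon\in\{+1,-1\}$ and $g\ge1$. A polynomial $\Delta(t)\in\mathbb{Q}[t]$ is the Alexander polynomial $\det(tA-\epsilon A^T)$ of some $2g\times2g$ rational Seifert matrix $A$ if and only if (1) $\Delta(t)=\Delta(t^{-1})t^{2g}$, (2) $\Delta(\epsilon)$ is a square in $\mathbb{Q}$, and (3) $\epsilon^g\Delta(1)$ is a nonzero square in $\mathbb{Q}$.
   Context: A \emph{rational Seifert matrix} (with respect to $\epsilon$) is a square matrix $A$ over $\mathbb{Q}$ such that for some rational square matrix $P$ the matrix $P(A-\epsilon A^T)P^T$ is integral, even (all diagonal entries are even), and unimodular (invertible over $\mathbb{Z}$). Its Alexander polynomial is $\Delta_A(t)=\det(tA-\epsilon A^T)$. *)

(* Defs.v *)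
From mathcomp Require Import all_boot all_order all_algebra.

Set Implicit Arguments.
Unset Strict Implicit.
Unset Printing Implicit Defensive.

Import Order.TTheory GRing.Theory Num.Theory.

Local Open Scope ring_scope.

Definition rational_Seifert_matrix (eps : rat) (n : nat) (A : 'M[rat]_n) : Prop :=
  exists (P : 'M[rat]_n) (B : 'M[int]_n),
    [/\ P *m (A - eps *: A^T) *m P^T = map_mx intr B,
        forall i : 'I_n, (2 %| B i i)%Z
      & B \in unitmx].

Definition Alexander_poly (eps : rat) (n : nat) (A : 'M[rat]_n) : {poly rat} :=
  \det ('X *: map_mx polyC A - eps%:P *: map_mx polyC A^T).

Notation "x %:F" := (FracField.tofrac x) : ring_scope.

(* D(t^-1), taken in the field Q(t) of rational functions. *)
Definition subst_inv (D : {poly rat}) : {fraction {poly rat}} :=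
  (map_poly (fun c : rat => c%:P%:F) D).[('X%:F)^-1].

Definition rat_square (x : rat) : Prop := exists r : rat, x = r ^+ 2.

(* Main.v *)
Require Import Defs.
From mathcomp Require Import all_boot all_order all_algebra perm.
From mathcomp Require Import ring zify.

(** Put W = A - eps A^T and Z = A + eps A^T.  Then W^T = - eps W, Z^T = eps Z
    and, with x = (t + 1) / 2 and y = (t - 1) / 2,

      t A - eps A^T = x W + y Z,

    so that choosing A amounts to choosing a nondegenerate (-eps)-symmetric W
    and an eps-symmetric Z.  The substitution t -> 1/t becomes
    (x, y) -> (x/t, - y/t), hence the polynomials with
    Delta(t) = Delta(1/t) t^2g are exactly the x^2g G(y/x) with G even of degree
    at most 2g; moreover Delta(1) = G(0) and Delta(-1) is the coefficient of z^2g
    in G.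

    Necessity.  The symmetry comes from transposing the determinant.  The
    number Delta(eps) is, up to the factor eps^2g = 1, the determinant of the
    skew matrix A - A^T, hence a square ([det_skew_square]).  For eps = 1 the
    same matrix gives Delta(1).  For eps = -1, Delta(1) is the determinant of a
    form which is rationally equivalent to an even unimodular form of rank 2g,
    and such a form has determinant (-1)^g ([det_even_unimodular]): if
    B = R + R^T over the integers, the integral polynomial det(t R + R^T) is
    palindromic, so its values at 1 and -1 agree modulo 4 up to the sign
    (-1)^g, while its value at -1 is a rational square, hence 1 modulo 4 if odd.

    Sufficiency.  If W has an isotropic subspace of half the dimension, it is
    rationally equivalent to the standard hyperbolic (for eps = -1) or
    symplectic (for eps = 1) form, which is integral, even and unimodular
    ([Seifert_of_isotropic]).  It remains to realize a given even G as
    det(W + z Z) with W of this kind.  Take two coordinates u and v,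
    and a chain v = q_0, q_1, ..., q_(g-1) coupled to dual isotropic
    coordinates p_1, ..., p_(g-1), where W pairs p_i with q_i and Z pairs p_i
    with q_(i-1).  Eliminating the p_i imposes q_i = - z q_(i-1), that is
    q_i = (- z)^i v on one side and q_i = z^i v on the other, so the
    determinant collapses to a 2 x 2 determinant in u and v ([det_chain]) in
    which the entries of Z on the chain appear linearly as the coefficients of
    powers of z.  For eps = 1 a diagonal Z on the chain produces all the
    coefficients.  For eps = -1 the chain block of Z is skew and its entries
    next to the diagonal produce all the coefficients but the extreme ones; the
    coefficient of z^2g arises as p^2, from a coupling p between u and the end
    of the chain.  This is how the condition that Delta(-1) be a square
    enters. *)

Set Implicit Arguments.
Unset Strict Implicit.
Unset Printing Implicit Defensive.

Import Order.TTheory GRing.Theory Num.Theory.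

Local Open Scope ring_scope.

(** * Determinants of skew-symmetric matrices *)

Lemma det_mx2 (R : comNzRingType) (A : 'M[R]_2) :
  \det A = A 0 0 * A 1 1 - A 0 1 * A 1 0.
Proof.
have e1 : lift 0 (0 : 'I_1) = 1 :> 'I_2 by apply/val_inj.
have e2 : lift 1 (0 : 'I_1) = 0 :> 'I_2 by apply/val_inj.
rewrite (expand_det_row _ 0) !big_ord_recl big_ord0 addr0 /cofactor.
rewrite !det_mx11 !mxE !e1 !e2.
by rewrite expr0 expr1 mul1r mulN1r mulrN.
Qed.

Lemma det_schur_ul (F : fieldType) m n (P : 'M[F]_m) (B : 'M_(m, n)) (C : 'M_(n, m))
    (S : 'M_n) :
  P \in unitmx -> \det (block_mx P B C S) = \det P * \det (S - C *m invmx P *m B).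
Proof.
move=> Pu.
have -> : block_mx P B C S =
    block_mx 1%:M 0 (C *m invmx P) 1%:M *m block_mx P B 0 (S - C *m invmx P *m B).
  rewrite mulmx_block !mul1mx !mul0mx !addr0 mulmxKV //.
  by rewrite addrCA subrr addr0.
by rewrite det_mulmx det_lblock det_ublock !det1 !mul1r.
Qed.

(** Splitting off a hyperbolic plane leaves a smaller skew Schur complement, and
    the plane contributes the square of its off-diagonal entry. *)
Lemma det_skew_square (F : numFieldType) n (K : 'M[F]_n) :
  K^T = - K -> exists r : F, \det K = r ^+ 2.
Proof.
elim/ltn_ind: n K => -[|[|n]] IH K skewK.
- by exists 1; rewrite det_mx00 expr1n.
- have diag0 i : K i i = 0.
    by apply/eqP; have /matrixP/(_ i i) := skewK; rewrite !mxE -eqNr => <-.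
  by exists 0; rewrite det_mx11 diag0 expr0n.
have skewE i j : K i j = - K j i.
  by have /matrixP/(_ j i) := skewK; rewrite !mxE.
have diag0 i : K i i = 0 by apply/eqP; rewrite -eqNr -skewE.
have [row0|] := boolP [forall j, K 0 j == 0].
  exists 0; rewrite (expand_det_row _ 0) expr0n big1 // => j _.
  by rewrite (eqP (forallP row0 j)) mul0r.
rewrite negb_forall => /existsP[j K0j].
have j0 : j != 0 by apply: contraNneq K0j => ->; rewrite diag0.
(* Conjugating by s moves the nonzero entry to position (0, 1). *)
pose s := tperm (1 : 'I_n.+2) j.
have s0 : s 0 = 0 by rewrite /s tpermD // eq_sym.
pose K1 : 'M[F]_(2 + n) := \matrix_(a, b) K (s a) (s b).
have detK1 : \det K1 = \det K.
  have -> : K1 = row_perm s (col_perm s K) by apply/matrixP=> a b; rewrite !mxE.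
  rewrite row_permE col_permE !det_mulmx !det_perm.
  by rewrite mulrCA mulrA -mulrA odd_permV -signr_addb addbb mulr1.
have skewK1 : K1^T = - K1 by apply/matrixP=> a b; rewrite !mxE skewE.
pose P := ulsubmx K1; pose B := ursubmx K1; pose S := drsubmx K1.
have dlE : dlsubmx K1 = - B^T.
  by rewrite /B trmx_ursub skewK1; apply/matrixP=> a b; rewrite !mxE opprK.
have skewS : S^T = - S.
  by rewrite /S trmx_drsub skewK1; apply/matrixP=> a b; rewrite !mxE.
have skewP : P^T = - P.
  by rewrite /P trmx_ulsub skewK1; apply/matrixP=> a b; rewrite !mxE.
have P01 : P 0 1 = K 0 j.
  rewrite !mxE (_ : lshift n 0 = 0 :> 'I_(2 + n)); last exact/val_inj.
  rewrite (_ : lshift n 1 = 1 :> 'I_(2 + n)); last exact/val_inj.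
  by rewrite s0 /s tpermL.
have detP : \det P = (K 0 j) ^+ 2.
  have Pd i : P i i = 0 by rewrite !mxE diag0.
  have P10 : P 1 0 = - P 0 1 by have /matrixP/(_ 0 1) := skewP; rewrite !mxE.
  by rewrite det_mx2 !Pd P10 P01; ring.
have Pu : P \in unitmx by rewrite unitmxE detP unitfE expf_neq0.
have skewC : (S + B^T *m invmx P *m B)^T = - (S + B^T *m invmx P *m B).
  rewrite linearD /= !trmx_mul trmxK trmx_inv skewP skewS.
  have -> : invmx (- P) = - invmx P.
    have nPu : - P \in unitmx by rewrite -scaleN1r unitmxZ ?unitrN1.
    apply: (can_inj (mulKmx nPu)).
    by rewrite mulmxV // mulNmx mulmxN opprK mulmxV.
  by rewrite mulNmx mulmxN mulmxA opprD.
have [r detC] := IH n (ltnW (ltnSn _)) _ skewC.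
exists (K 0 j * r).
rewrite -detK1 -(submxK K1) -/P -/B -/S dlE det_schur_ul // !mulNmx opprK.
by rewrite detC detP exprMn.
Qed.

(** * Palindromic polynomials *)

(** The identity D(t) = D(1/t) t^m read off on coefficients: as D(1/t) t^m has
    only powers of t up to t^m, those of D beyond m vanish. *)
Definition palindromic (R : nzRingType) (m : nat) (D : {poly R}) : Prop :=
  forall i : nat, D`_i = if (i <= m)%N then D`_(m - i) else 0.

Lemma palindromic_of_subst_inv m (D : {poly rat}) :
  D%:F = subst_inv D * ('X%:F) ^+ m -> palindromic m D.
Proof.
pose s := size D.
have Xn0 : ('X : {poly rat})%:F != 0 by rewrite tofrac_eq0 polyX_eq0.
(* Multiplying by a further 'X^s turns the identity of rational functions into
   one of polynomials. *)
have cleared : subst_inv D * ('X%:F) ^+ s = (\sum_(i < s) D`_i *: 'X^(s - i))%:F.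
  rewrite /subst_inv /map_poly horner_poly mulr_suml rmorph_sum.
  apply: eq_bigr => i _ /=.
  rewrite -mul_polyC rmorphM rmorphXn /= -mulrA; congr (_ * _).
  by rewrite exprVn mulrC -expfB // ltnW.
move=> DE.
have {DE cleared} : D * 'X^s = (\sum_(i < s) D`_i *: 'X^(s - i)) * 'X^m.
  apply/eqP; rewrite -tofrac_eq !rmorphM !rmorphXn /= -cleared.
  by rewrite {1}DE mulrAC.
move=> DE i.
have -> : D`_i = (D * 'X^s)`_(s + i) by rewrite coefMXn ltnNge leq_addr /= addKn.
rewrite DE coefMXn coef_sum.
have [lt_si|le_si] := ltnP (s + i) m.
  by rewrite leqNgt [in X in ~~ X]ltnNge (leq_trans (leq_addl s i) (ltnW lt_si)) /=
    nth_default // leq_subRL ?(leq_trans (leq_addl s i) (ltnW lt_si)) // addnC ltnW.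
rewrite (eq_bigr (fun j : 'I_s => if (i + j == m)%N then D`_j else 0)); last first.
  move=> j _; rewrite coefZ coefXn.
  have -> : (s + i - m == s - j)%N = (i + j == m)%N by have := ltn_ord j; lia.
  by case: ifP => _; rewrite ?mulr1 ?mulr0.
have [le_im|lt_mi] := leqP i m; last first.
  by rewrite big1 // => j _; rewrite ifF //; apply/negP; lia.
have [lt_s|le_s] := ltnP (m - i) s.
  rewrite (bigD1 (Ordinal lt_s)) //= subnKC // eqxx big1 ?addr0 // => j.
  rewrite -val_eqE /= => jn; rewrite ifF //; apply/negP; lia.
rewrite nth_default // big1 // => j _; rewrite ifF //; apply/negP.
by have := ltn_ord j; lia.
Qed.

Lemma map_Alexander_poly (R : comNzRingType) (f : {rmorphism {poly rat} -> R})
    (eps : rat) n (A : 'M[rat]_n) :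
  f (Alexander_poly eps A) =
    \det (f 'X *: map_mx (f \o polyC) A - f eps%:P *: map_mx (f \o polyC) A^T).
Proof.
by rewrite -det_map_mx; congr (\det _); apply/matrixP=> i j; rewrite !mxE rmorphB !rmorphM.
Qed.

Lemma horner_Alexander_poly (eps : rat) n (A : 'M[rat]_n) t :
  (Alexander_poly eps A).[t] = \det (t *: A - eps *: A^T).
Proof.
rewrite -[LHS]/(horner_eval t _) map_Alexander_poly /=; congr (\det _).
by apply/matrixP=> i j; rewrite !mxE /= /horner_eval hornerX !hornerC.
Qed.

(** The reciprocal of t A - eps A^T is, up to a factor t, - eps times its
    transpose; the sign disappears in even dimension. *)
Lemma Alexander_poly_subst_inv (eps : rat) n (A : 'M[rat]_n) :
  eps ^+ 2 = 1 -> ~~ odd n ->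
  (Alexander_poly eps A)%:F = subst_inv (Alexander_poly eps A) * ('X%:F) ^+ n.
Proof.
move=> eps2 evn.
have Xn0 : ('X : {poly rat})%:F != 0 by rewrite tofrac_eq0 polyX_eq0.
pose f : {rmorphism rat -> {fraction {poly rat}}} := @FracField.tofrac {poly rat} \o polyC.
(* subst_inv is a ring morphism, so it can be moved inside the determinant. *)
pose phi : {rmorphism {poly rat} -> {fraction {poly rat}}} :=
  horner_eval ('X%:F)^-1 \o map_poly f.
have phiE D : subst_inv D = phi D by [].
have phiC c : phi c%:P = f c by rewrite /phi /= /horner_eval map_polyC hornerC.
have phiX : phi 'X = ('X%:F)^-1 by rewrite /phi /= /horner_eval map_polyX hornerX.
have detN (M : 'M_n) : \det (- f eps *: M^T) = \det M.
  rewrite detZ det_tr (_ : (- f eps) ^+ n = 1) ?mul1r //.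
  rewrite -(odd_double_half n) (negbTE evn) add0n -mul2n exprM sqrrN.
  by rewrite -rmorphXn eps2 rmorph1 expr1n.
rewrite phiE !map_Alexander_poly mulrC -detZ -[LHS]detN.
have ee : f eps * f eps = 1 by rewrite -rmorphM -expr2 eps2 rmorph1.
congr (\det _); apply/matrixP=> i j; rewrite !mxE phiC phiX.
rewrite -[LHS]/(- f eps * ('X%:F * f (A j i) - f eps * f (A i j))).
rewrite -[(phi \o _) (A i j)]/(phi (A i j)%:P) -[(phi \o _) (A j i)]/(phi (A j i)%:P).
rewrite !phiC.
rewrite [RHS]mulrBr [in RHS]mulrA divff // -{1}ee; ring.
Qed.

(** * Even unimodular integral forms *)

Lemma sum_palindrome (V : zmodType) (f : nat -> V) g :
  (forall i, (i < g)%N -> f (2 * g - i)%N = f i) -> f g = 0 ->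
  \sum_(i < (2 * g).+1) f i = (\sum_(i < g) f i) *+ 2.
Proof.
move=> fE fg0; rewrite -!(big_mkord predT f).
rewrite (@big_cat_nat _ _ _ g) //=; last by lia.
rewrite (@big_ltn _ _ _ g) ?fg0 ?add0r; last by lia.
rewrite mulr2n; congr (_ + _).
rewrite -{1}(add0n g.+1) big_addn (_ : ((2 * g).+1 - g.+1 = g)%N); last by lia.
rewrite big_nat_rev /= !big_mkord; apply: eq_bigr => i _.
rewrite -[RHS]fE //; congr (f _); have := ltn_ord i; lia.
Qed.

Lemma size_palindromic (R : nzRingType) m (D : {poly R}) :
  palindromic m D -> (size D <= m.+1)%N.
Proof. by move=> palD; apply/leq_sizeP => i lt_mi; rewrite palD leqNgt lt_mi. Qed.

(** In D(1) - (-1)^g D(-1) only the coefficients of index i with g + i odd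
    survive, each with a factor 2; the symmetry i <-> 2g - i, which fixes only
    i = g, supplies another factor 2. *)
Lemma palindromic_mod4 g (D : {poly int}) :
  palindromic (2 * g) D -> exists k : int, D.[1] - (-1) ^+ g * D.[-1] = 4 * k.
Proof.
move=> palD; have sD := size_palindromic palD.
pose f i : int := D`_i * (1 - (-1) ^+ (g + i)).
have -> : D.[1] - (-1) ^+ g * D.[-1] = \sum_(i < (2 * g).+1) f i.
  rewrite !(horner_coef_wide _ sD) mulr_sumr -sumrB; apply: eq_bigr => i _.
  by rewrite /f expr1n mulr1 mulrBr mulr1 exprD mulrCA.
rewrite sum_palindrome; first last.
- by rewrite /f addnn -mul2n exprM sqrrN !expr1n subrr mulr0.
- move=> i lt_ig; rewrite /f [in RHS]palD ifT; last by lia.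
  congr (_ * (1 - _)); rewrite -signr_odd -[RHS]signr_odd; congr (_ ^+ _).
  by congr (nat_of_bool _); lia.
exists (\sum_(i < g) D`_i * odd (g + i)%N).
rewrite -sumrMnl mulr_sumr; apply: eq_bigr => i _.
by rewrite /f -signr_odd; case: odd => /=; ring.
Qed.

(** Write the square root in lowest terms as a / b, so that a^2 = m b^2.  If m
    were 3 modulo 4, reduction modulo 4 would make both a and b even. *)
Lemma rat_square_odd_mod4 (m : int) :
  rat_square m%:~R -> (exists k, m = 2 * k + 1) -> exists k, m = 4 * k + 1.
Proof.
move=> [r rE] [j mE].
have numE : numq r ^+ 2 = m * denq r ^+ 2.
  have numr : (numq r)%:~R = r * (denq r)%:~R.
    by rewrite -{2}(divq_num_den r) divfK // intr_eq0 denq_neq0.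
  apply/eqP; rewrite -(eqr_int rat) !expr2 !intrM rE numr; apply/eqP; ring.
have half (x : int) : exists a : int, x = 2 * a \/ x = 2 * a + 1.
  by exists (x %/ 2)%Z; lia.
have [a aE] := half (numq r); have [b bE] := half (denq r).
have [k kE] := half j.
have cop := coprime_num_den r.
case: kE mE => -> mE; first by exists k; rewrite mE; ring.
exfalso; case: aE bE => aE [bE|bE].
- move: cop; rewrite aE bE !abszM /coprime; have -> : `|2|%N = 2%N by [].
  by rewrite -muln_gcdr; lia.
- move: numE; rewrite aE bE mE; lia.
- move: numE; rewrite aE bE mE; lia.
- move: numE; rewrite aE bE mE; lia.
Qed.

(** Evenness is what allows writing B = R + R^T with R integral. *)
Lemma det_even_unimodular g (B : 'M[int]_(2 * g)) :
  B^T = B -> (forall i, (2 %| B i i)%Z) -> B \in unitmx -> \det B = (-1) ^+ g.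
Proof.
move=> symB evB Bu.
have BE i j : B i j = B j i by rewrite -{1}symB mxE.
pose R : 'M[int]_(2 * g) := \matrix_(i, j)
  if (i < j)%N then B i j else if i == j then (B i i %/ 2)%Z else 0.
have RE : B = R + R^T.
  apply/matrixP => i j; rewrite !mxE; case: (ltngtP i j) => [ij|ij|/val_inj <-].
  - by rewrite -val_eqE /= gtn_eqF // addr0.
  - by rewrite -val_eqE /= gtn_eqF // add0r.
  - by rewrite eqxx; have := evB i; lia.
pose D : {poly int} := \det ('X *: map_mx polyC R + map_mx polyC R^T).
have DE t : D.[t] = \det (t *: R + R^T).
  rewrite -[LHS]/(horner_eval t _) -det_map_mx; congr (\det _).
  by apply/matrixP => i j; rewrite !mxE /= /horner_eval !hornerE.
have AE : Alexander_poly (-1) (map_mx intr R) = map_poly intr D.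
  rewrite -[RHS]det_map_mx; congr (\det _); apply/matrixP => i j.
  by rewrite !mxE !polyCN mulN1r opprK rmorphD rmorphM /= map_polyX !map_polyC.
have palD : palindromic (2 * g) D.
  have := @Alexander_poly_subst_inv (-1) _ (map_mx intr R : 'M[rat]_(2 * g)).
  have ev : ~~ odd (2 * g) by rewrite mul2n odd_double.
  rewrite sqrrN expr1n => /(_ erefl ev) /palindromic_of_subst_inv.
  rewrite AE => pal i; apply/eqP; rewrite -(eqr_int rat); apply/eqP.
  by have := pal i; rewrite !coef_map /= => ->; case: ifP.
have [k kE] := palindromic_mod4 palD.
have sqD : rat_square (D.[-1])%:~R.
  have skew : (map_mx (intr : int -> rat) (-1 *: R + R^T))^T =
      - map_mx (intr : int -> rat) (-1 *: R + R^T).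
    by apply/matrixP => i j; rewrite !mxE; rewrite -rmorphN /=; congr (_%:~R); ring.
  have [r rE] := det_skew_square skew.
  by exists r; rewrite -rE DE -det_map_mx.
have detB : D.[1] = \det B by rewrite DE scale1r -RE.
have unB : \det B = 1 \/ \det B = -1.
  by move: Bu; rewrite unitmxE => /orP[] /eqP ->; [left|right].
have sg : (-1) ^+ g = 1 :> int \/ (-1) ^+ g = -1 :> int.
  by rewrite -signr_odd; case: odd; [right|left].
have [l lE] : exists l, D.[-1] = 4 * l + 1.
  apply: rat_square_odd_mod4 => //; exists (D.[-1] %/ 2)%Z.
  by move: kE; rewrite detB; case: sg unB => -> [] ->; lia.
by move: kE; rewrite detB lE; case: sg unB => -> [] ->; lia.
Qed.

(** * Necessity of the conditions *)

Lemma Alexander_poly_Seifert (eps : rat) g (A : 'M[rat]_(2 * g)) :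
  eps = 1 \/ eps = -1 -> rational_Seifert_matrix eps A ->
  [/\ (Alexander_poly eps A)%:F = subst_inv (Alexander_poly eps A) * ('X%:F) ^+ (2 * g),
      rat_square (Alexander_poly eps A).[eps]
    & eps ^+ g * (Alexander_poly eps A).[1] != 0 /\
      rat_square (eps ^+ g * (Alexander_poly eps A).[1])].
Proof.
move=> heps [P [B [PWE evB Bu]]].
have eps2 : eps ^+ 2 = 1 by case: heps => ->; rewrite ?sqrrN expr1n.
have epsn0 : eps != 0 by case: heps => ->.
set W := A - eps *: A^T in PWE.
have WT : W^T = - eps *: W.
  apply/matrixP => i j; rewrite !mxE.
  by rewrite -[A j i]mul1r -{1}eps2; ring.
have D1 : (Alexander_poly eps A).[1] = \det W by rewrite horner_Alexander_poly scale1r.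
have detW : \det P ^+ 2 * \det W = (\det B)%:~R.
  by rewrite -det_map_mx -PWE !det_mulmx det_tr; ring.
have detBn0 : (\det B)%:~R != 0 :> rat.
  by rewrite intr_eq0; apply: contraTneq Bu => B0; rewrite unitmxE B0 unitr0.
have Wn0 : \det W != 0 by apply: contraNneq detBn0 => W0; rewrite -detW W0 mulr0.
have Pn0 : \det P != 0 by apply: contraNneq detBn0 => P0; rewrite -detW P0 expr0n mul0r.
split.
- by apply: Alexander_poly_subst_inv => //; rewrite mul2n odd_double.
- rewrite horner_Alexander_poly; apply: det_skew_square.
  by apply/matrixP => i j; rewrite !mxE; ring.
- rewrite D1; split; first by rewrite mulf_neq0 ?expf_neq0.
  case: heps => epsE.
    rewrite epsE expr1n mul1r; apply: det_skew_square.
    by rewrite WT epsE scaleN1r.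
  have symB : B^T = B.
    apply/matrixP => i j; apply/eqP; rewrite -(eqr_int rat) mxE.
    have symPW : (P *m W *m P^T)^T = P *m W *m P^T.
      by rewrite !trmx_mul trmxK WT epsE opprK scale1r mulmxA.
    by move/matrixP/(_ i j): symPW; rewrite PWE !mxE => ->.
  exists (\det P)^-1.
  have detB := det_even_unimodular symB evB Bu.
  have sg2 : (-1) ^+ g * (-1) ^+ g = 1 :> rat by rewrite -exprMn mulrNN mulr1 expr1n.
  apply: (mulfI (expf_neq0 2 Pn0)).
  rewrite exprVn divff ?expf_neq0 // mulrCA detW detB epsE.
  by rewrite rmorphXn /= rmorphN1.
Qed.

(** * Forms with a half-dimensional isotropic subspace *)

(** By nondegeneracy the rows of U have a dual family V; replacing V by V + H U
    with H = - S / 2, where S is the Gram matrix of V, makes it isotropic. *)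
Lemma isotropic_hyperbolic (F : numFieldType) (e : F) g m (W : 'M[F]_m) (U : 'M_(g, m)) :
  e ^+ 2 = 1 -> W^T = - e *: W -> W \in unitmx -> row_free U -> U *m W *m U^T = 0 ->
  exists P : 'M_(g + g, m), P *m W *m P^T = block_mx 0 1%:M (- e%:M) 0.
Proof.
move=> e2 WT Wu /row_freeP[B UB] isoU.
pose V := (invmx W *m B)^T.
have UWV : U *m W *m V^T = 1%:M by rewrite trmxK mulmxA mulmxK.
have VWU : V *m W *m U^T = - e%:M.
  have -> : V *m W = - e *: (W *m V^T)^T.
    by rewrite trmx_mul trmxK WT -scalemxAr scalerA mulrNN -expr2 e2 scale1r.
  rewrite -scalemxAl -trmx_mul mulmxA UWV trmx1 scaleNr; congr (- _).
  by rewrite scalemx1.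
pose S := V *m W *m V^T.
have ST : S^T = - e *: S.
  by rewrite !trmx_mul trmxK WT -scalemxAl -scalemxAr mulmxA.
pose H := - 2^-1 *: S.
have VWV : S + V *m W *m (H *m U)^T + (H *m U *m W *m V^T + H *m U *m W *m (H *m U)^T) = 0.
  rewrite -!(mulmxA H) trmx_mul !mulmxA -!(mulmxA H) isoU UWV VWU mul0mx mulmx0 addr0 mulmx1.
  rewrite /H linearZ /= ST mulNmx -scalemxAr -scalemxAr mul_scalar_mx !scalerA -scaleNr.
  rewrite -[X in X + _ + _]scale1r -!scalerDl.
  have -> : 1 - - 2^-1 * - e * e - 2^-1 = 1 - 2^-1 * e ^+ 2 - 2^-1 :> F by ring.
  by rewrite e2 (_ : _ - _ = 0) ?scale0r //; field.
exists (col_mx U (V + H *m U)).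
rewrite tr_col_mx mul_col_mx mul_col_row linearD /= !mulmxDl !mulmxDr -/S.
rewrite isoU UWV VWU VWV trmx_mul !mulmxA isoU mul0mx addr0.
by rewrite -!(mulmxA H) isoU mulmx0 addr0.
Qed.

(** The hyperbolic basis is rational and its Gram matrix, with entries 0, 1 and
    - eps and zero diagonal, is integral, even and unimodular. *)
Lemma Seifert_of_isotropic (eps : rat) g n (A : 'M[rat]_n) (U : 'M_(g, n)) :
  eps = 1 \/ eps = -1 -> n = (g + g)%N ->
  A - eps *: A^T \in unitmx -> row_free U -> U *m (A - eps *: A^T) *m U^T = 0 ->
  rational_Seifert_matrix eps A.
Proof.
move=> heps nE; subst n.
move=> Wu Ufree isoU.
have eps2 : eps ^+ 2 = 1 by case: heps => ->; rewrite ?sqrrN expr1n.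
have [|P PWE] := isotropic_hyperbolic eps2 _ Wu Ufree isoU.
  by apply/matrixP => i j; rewrite !mxE -[A j i]mul1r -{1}eps2; ring.
have [e epsE e2] : exists2 e : int, eps = e%:~R & e * e = 1.
  by case: heps => ->; [exists 1|exists (-1)].
exists P, (block_mx 0 1%:M (- e%:M) 0); split.
- by rewrite PWE map_block_mx !map_mx0 map_mx1 map_mxN map_scalar_mx epsE.
- move=> i; case: (split_ordP i) => j ->; first by rewrite block_mxEul mxE dvdz0.
  by rewrite block_mxEdr mxE dvdz0.
- have : block_mx 0 1%:M (- e%:M) 0 *m block_mx 0 (- e%:M) 1%:M 0
      = 1%:M :> 'M[int]_(g + g).
    rewrite mulmx_block !mul0mx !mulmx0 !mul1mx !addr0 !add0r mulmxN mulNmx opprK.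
    by rewrite -scalar_mxM e2 -scalar_mx_block.
  by case/mulmx1_unit.
Qed.

(** * The determinant of a chain pencil *)

Lemma det_swap_mx (R : comNzRingType) n : \det (block_mx 0 (- 1%:M) 1%:M 0 : 'M[R]_(n + n)) = 1.
Proof.
have -> : block_mx 0 (- 1%:M) 1%:M 0 =
    block_mx 1%:M (- 1%:M) 0 1%:M *m block_mx 1%:M 0 1%:M 1%:M
      *m block_mx 1%:M (- 1%:M) 0 1%:M :> 'M[R]_(n + n).
  rewrite !mulmx_block !mul0mx !mulmx0 !mulmx1 ?mul1mx ?addr0 ?add0r.
  by rewrite subrr mul0mx sub0r mul1mx addNr.
by rewrite !det_mulmx !det_ublock det_lblock !det1 !mulr1.
Qed.

Lemma det_castmx (R : comNzRingType) m n (e : m = n) (A : 'M[R]_m) :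
  \det (castmx (e, e) A) = \det A.
Proof. by case: n / e; rewrite castmx_id. Qed.

(** The last n coordinates of D are paired perfectly with an isotropic block,
    so they can be used to clear everything but the first k coordinates. *)
Lemma det_corner (F : fieldType) k n (D : 'M[F]_(k + n)) (e : F) :
  e != 0 ->
  \det (block_mx D (- e *: (row_mx 0 1%:M)^T) (row_mx 0 1%:M) 0) = e ^+ n * \det (ulsubmx D).
Proof.
move=> en0; rewrite -{1}(submxK D).
set d := ulsubmx D; set c := ursubmx D; set b := dlsubmx D; set a := drsubmx D.
have -> : - e *: (row_mx 0 1%:M)^T = col_mx 0 (- e%:M) :> 'M[F]_(k + n, n).
  by rewrite tr_row_mx trmx0 trmx1 scale_col_mx scaler0 scalemx1 raddfN.
pose Q : 'M[F]_(n + n) := block_mx a (- e%:M) 1%:M 0.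
have -> : \det (block_mx (block_mx d c b a) (col_mx 0 (- e%:M)) (row_mx 0 1%:M) 0) =
    \det (block_mx d (row_mx c 0) (col_mx b 0) Q).
  by rewrite /Q block_mxA det_castmx.
have detQ : \det Q = e ^+ n.
  rewrite -[LHS]mulr1 -(det_swap_mx F n) -det_mulmx mulmx_block.
  rewrite !mulmx0 !mulmx1 !add0r !addr0 mul1mx det_ublock.
  by rewrite -!raddfN /= !det_scalar -exprMn mulrNN mulr1.
pose Y : 'M[F]_(n + n, k) := col_mx 0 (- e^-1 *: b).
have QY : Q *m Y = col_mx b 0.
  rewrite mul_block_col !mulmx0 mul0mx !add0r mulNmx mul_scalar_mx scalerA.
  by rewrite mulrN divff // scaleN1r opprK.
have cY : row_mx c 0 *m Y = 0 by rewrite mul_row_col mulmx0 mul0mx addr0.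
have -> : block_mx d (row_mx c 0) (col_mx b 0) Q =
    block_mx d (row_mx c 0) 0 Q *m block_mx 1%:M 0 Y 1%:M.
  by rewrite mulmx_block !mulmx0 !mulmx1 cY QY !add0r addr0.
by rewrite det_mulmx det_ublock det_lblock !det1 !mulr1 detQ mulrC.
Qed.

Section Chain.
Variables (F : fieldType) (n : nat).

(** The rows of up_mx + z low_mx express the relations q_(i+1) + z q_i = 0. *)
Definition up_mx : 'M[F]_(n, n.+1) := \matrix_(i, j) (j == i.+1 :> nat)%:R.
Definition low_mx : 'M[F]_(n, n.+1) := \matrix_(i, j) (j == i :> nat)%:R.
(** Its first column spans the kernel of up_mx - z low_mx, and the other
    columns bring that matrix to the form up_mx: see [chain_mul_geom]. *)
Definition geom_mx (z : F) : 'M[F]_n.+1 :=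
  \matrix_(i, j) if (j <= i)%N then z ^+ (i - j) else 0.

Lemma mul_up_mx p (T : 'M[F]_(n.+1, p)) i j : (up_mx *m T) i j = T (lift ord0 i) j.
Proof.
rewrite mxE (bigD1 (lift ord0 i)) //= mxE eqxx mul1r big1 ?addr0 // => k ki.
by rewrite mxE (negbTE (_ : _ != _)) ?mul0r.
Qed.

Lemma mul_low_mx p (T : 'M[F]_(n.+1, p)) i j :
  (low_mx *m T) i j = T (widen_ord (leqnSn n) i) j.
Proof.
rewrite mxE (bigD1 (widen_ord (leqnSn n) i)) //= mxE eqxx mul1r big1 ?addr0 // => k ki.
by rewrite mxE (negbTE (_ : _ != _)) ?mul0r.
Qed.

(** The coordinate u and the origin v of the chain are grouped into one block
    of size 2, the remainder of the chain forming a block of size n. *)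
Lemma pad_up_mx : row_mx (0 : 'M_(n, 1)) up_mx = row_mx 0 1%:M :> 'M_(n, 2 + n).
Proof.
apply/matrixP => i j; case: (split_ordP j) => k ->.
  rewrite [in RHS]row_mxEl !mxE; case: splitP => l /= lE; rewrite !mxE //.
  by case: eqP => // lE'; have := ltn_ord k; lia.
rewrite [in RHS]row_mxEr !mxE; case: splitP => l /= lE.
  by have := ltn_ord l; lia.
by rewrite mxE -val_eqE /=; congr (_%:R); congr (nat_of_bool _); lia.
Qed.

Lemma chain_mul_geom z : (up_mx + z *: low_mx) *m geom_mx (- z) = up_mx.
Proof.
apply/matrixP => i j; rewrite mulmxDl -scalemxAl mxE mul_up_mx [X in _ + X]mxE mul_low_mx !mxE /=.
rewrite /bump leq0n add1n -(ltnS j i).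
case: ltngtP => [lt_ji|_|->]; last by rewrite subnn expr0 mulr0 addr0.
  by rewrite subSn // exprS mulNr addNr.
by rewrite mulr0 addr0.
Qed.

Lemma pad_mul_geom z :
  row_mx (0 : 'M_(n, 1)) (up_mx + z *: low_mx) *m block_mx 1%:M 0 0 (geom_mx (- z)) =
  (row_mx 0 1%:M : 'M_(n, 2 + n)).
Proof.
by rewrite mul_row_block !mul0mx !mulmx0 addr0 add0r chain_mul_geom pad_up_mx.
Qed.

Lemma det_geom_mx z : \det (geom_mx z) = 1.
Proof.
rewrite det_trig; last by apply/is_trig_mxP => i j ij; rewrite mxE leqNgt ij.
by rewrite big1 // => i _; rewrite mxE leqnn subnn.
Qed.

(** The unipotent base change by [geom_mx], with parameters z on the left and
    - z on the right, makes the coupling blocks independent of z; then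
    [det_corner] leaves the 2 x 2 block of u and of the kernel vectors
    (z^i) and ((- z)^i). *)
Lemma det_chain (e z : F) (w : 'M[F]_1) (d : 'rV_n.+1) (d' : 'cV_n.+1) (C : 'M_n.+1) :
  e != 0 ->
  \det (block_mx (block_mx w d d' C : 'M_(1 + n.+1))
           (- e *: (row_mx 0 (up_mx - z *: low_mx))^T)
           (row_mx 0 (up_mx + z *: low_mx)) 0) =
  e ^+ n * (w 0 0 * (\sum_(i < n.+1) \sum_(j < n.+1) z ^+ i * C i j * (- z) ^+ j)
            - (\sum_(j < n.+1) d 0 j * (- z) ^+ j) * (\sum_(i < n.+1) z ^+ i * d' i 0)).
Proof.
move=> en0; set M := block_mx (block_mx w d d' C) _ _ _.
pose E t : 'M[F]_((1 + n.+1) + n) := block_mx (block_mx 1%:M 0 0 (geom_mx t)) 0 0 1%:M.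
have detE t : \det (E t) = 1 by rewrite !det_ublock det_geom_mx !det1 !mulr1.
pose D : 'M[F]_(1 + n.+1) := block_mx w (d *m geom_mx (- z)) ((geom_mx z)^T *m d')
       ((geom_mx z)^T *m C *m geom_mx (- z)).
have ME : (E z)^T *m M *m E (- z) =
    block_mx (D : 'M_(2 + n)) (- e *: (row_mx 0 1%:M)^T) (row_mx 0 1%:M) 0.
  rewrite tr_block_mx !trmx0 tr_block_mx !trmx0 !trmx1 !mulmx_block.
  rewrite !mul0mx !mulmx0 !mulmx1 !mul1mx ?addr0 ?add0r.
  congr block_mx.
  - rewrite mulmx_block !mulmx0 !mulmx1 ?add0r !addr0; congr block_mx.
  - rewrite -scalemxAr; congr (_ *: _).
    have /(congr1 trmx) := pad_mul_geom (- z); rewrite opprK scaleNr.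
    by rewrite trmx_mul tr_block_mx !trmx0 trmx1.
  - exact: pad_mul_geom.
have -> : \det M = e ^+ n * \det (ulsubmx (D : 'M_(2 + n))).
  transitivity (\det ((E z)^T *m M *m E (- z))).
    by rewrite !det_mulmx det_tr !detE mulr1 mul1r.
  rewrite ME; exact: (@det_corner F 2 n D e en0).
have DE a b : ulsubmx (D : 'M_(2 + n)) a b = D (lshift n a) (lshift n b).
  by rewrite mxE mxE.
have -> : \sum_(i < n.+1) \sum_(j < n.+1) z ^+ i * C i j * (- z) ^+ j =
    ((geom_mx z)^T *m C *m geom_mx (- z)) 0 0.
  rewrite exchange_big mxE; apply: eq_bigr => j _.
  rewrite mxE mulr_suml [geom_mx _ _ _]mxE leq0n subn0.
  by apply: eq_bigr => i _; rewrite !mxE leq0n subn0.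
have -> : \sum_(j < n.+1) d 0 j * (- z) ^+ j = (d *m geom_mx (- z)) 0 0.
  by rewrite mxE; apply: eq_bigr => j _; rewrite [geom_mx _ _ _]mxE leq0n subn0.
have -> : \sum_(i < n.+1) z ^+ i * d' i 0 = ((geom_mx z)^T *m d') 0 0.
  by rewrite mxE; apply: eq_bigr => j _; rewrite !mxE leq0n subn0.
have e0 : lshift n (0 : 'I_2) = lshift n.+1 (0 : 'I_1) :> 'I_(1 + n.+1) by apply/val_inj.
have e1 : lshift n (1 : 'I_2) = rshift 1 (0 : 'I_n.+1) :> 'I_(1 + n.+1) by apply/val_inj.
by rewrite det_mx2 !DE e0 e1 /D block_mxEul block_mxEur block_mxEdl block_mxEdr.
Qed.
End Chain.

(** * Even polynomials attached to palindromic ones *)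

Lemma poly_eq_nat (R : numDomainType) (p q : {poly R}) :
  (forall n : nat, p.[n%:R] = q.[n%:R]) -> p = q.
Proof.
move=> pq; apply/eqP; rewrite -subr_eq0; apply/eqP.
pose rs : seq R := [seq n%:R | n <- iota 0 (size (p - q))].
apply: (@roots_geq_poly_eq0 _ _ rs).
- by apply/allP => _ /mapP[n _ ->]; rewrite rootE hornerD hornerN pq subrr.
- by rewrite map_inj_uniq ?iota_uniq //; apply: mulrIn; rewrite oner_eq0.
- by rewrite size_map size_iota.
Qed.

(** With z = (t - 1) / (t + 1) one has t = x (1 + z) and 1 = x (1 - z) for
    x = (t + 1) / 2, hence G(z) is the sum of the D_i (1 + z)^i (1 - z)^(2g - i),
    and the symmetry of the D_i exchanges z and - z. *)
Lemma cayley_palindromic g (D : {poly rat}) :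
  palindromic (2 * g) D ->
  exists G : {poly rat},
    [/\ (size G <= (2 * g).+1)%N, forall i, odd i -> G`_i = 0,
        D.[1] = G`_0, D.[-1] = G`_(2 * g)
      & forall t, t != -1 -> D.[t] = ((t + 1) / 2) ^+ (2 * g) * G.[(t - 1) / (t + 1)]].
Proof.
move=> palD; have sD := size_palindromic palD.
have splitX (x : rat) k : (k <= 2 * g)%N -> x ^+ (2 * g) = x ^+ k * x ^+ (2 * g - k).
  by move=> le_k; rewrite -exprD subnKC.
pose G : {poly rat} := \sum_(i < (2 * g).+1) D`_i *: ((1 + 'X) ^+ i * (1 - 'X) ^+ (2 * g - i)).
have GE z : G.[z] = \sum_(i < (2 * g).+1) D`_i * ((1 + z) ^+ i * (1 - z) ^+ (2 * g - i)).
  by rewrite horner_sum; apply: eq_bigr => i _; rewrite !hornerE.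
have sG : (size G <= (2 * g).+1)%N.
  apply: (leq_trans (size_sum _ _ _)); apply/bigmax_leqP => i _.
  apply: (leq_trans (size_scale_leq _ _)); apply: (leq_trans (size_polyMleq _ _)).
  have s1 : size (1 + 'X : {poly rat}) = 2%N by rewrite addrC size_XaddC.
  have s2 : size (1 - 'X : {poly rat}) = 2%N by rewrite -opprB size_polyN size_XsubC.
  have := size_poly_exp_leq (1 + 'X : {poly rat}) i.
  have := size_poly_exp_leq (1 - 'X : {poly rat}) (2 * g - i); rewrite s1 s2.
  move: (ltn_ord i); move: (size _) (size _) => a b; lia.
clearbody G.
have GN z : G.[- z] = G.[z].
  rewrite !GE (reindex_inj rev_ord_inj) /=; apply: eq_bigr => i _.
  have le_i : (i <= 2 * g)%N by rewrite -ltnS.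
  rewrite subSS opprK (palD i) le_i subKn //; congr (_ * _); exact: mulrC.
have Godd i : odd i -> G`_i = 0.
  move=> oddi; have [lt_ig|] := ltnP i (2 * g).+1; last first.
    by move=> le_gi; rewrite nth_default // (leq_trans sG).
  (* H(z) = G(- z). *)
  pose H : {poly rat} := \poly_(i < (2 * g).+1) ((-1) ^+ i * G`_i).
  have HG : H = G.
    apply: poly_eq_nat => n; rewrite horner_poly -GN (horner_coef_wide _ sG).
    by apply: eq_bigr => j _; rewrite [in RHS]exprNn mulrA [G`_j * _]mulrC.
  apply/eqP; have := congr1 (fun p : {poly rat} => p`_i) HG.
  by rewrite /= coef_poly lt_ig -signr_odd oddi expr1 mulN1r => /eqP; rewrite eqNr.
have DG t : t != -1 -> D.[t] = ((t + 1) / 2) ^+ (2 * g) * G.[(t - 1) / (t + 1)].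
  rewrite -subr_eq0 opprK => t1.
  rewrite (horner_coef_wide _ sD) GE mulr_sumr; apply: eq_bigr => i _.
  rewrite mulrCA; congr (_ * _).
  have le_i : (i <= 2 * g)%N by rewrite -ltnS.
  rewrite (splitX _ _ le_i) mulrACA -!exprMn.
  have -> : (t + 1) / 2 * (1 + (t - 1) / (t + 1)) = t by field.
  have -> : (t + 1) / 2 * (1 - (t - 1) / (t + 1)) = 1 by field.
  by rewrite expr1n mulr1.
exists G; split=> //.
- rewrite DG // subrr mul0r horner_coef0 (_ : (1 + 1) / 2 = 1) ?expr1n ?mul1r //.
- pose x : {poly rat} := 2^-1 *: ('X + 1); pose y : {poly rat} := 2^-1 *: ('X - 1).
  (* The value at t = -1 is a value at y/x = infinity: homogenize first. *)
  have -> : D = \sum_(k < (2 * g).+1) G`_k *: (x ^+ (2 * g - k) * y ^+ k).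
    apply: poly_eq_nat => n; rewrite DG; last by rewrite gt_eqF // (lt_le_trans (ltrN10 _)).
    rewrite horner_sum (horner_coef_wide _ sG) mulr_sumr; apply: eq_bigr => k _.
    rewrite mulrCA hornerZ; congr (_ * _); rewrite hornerM !horner_exp !hornerE.
    have le_k : (k <= 2 * g)%N by rewrite -ltnS.
    rewrite (splitX _ _ le_k) mulrAC -exprMn mulrC; congr (_ ^+ _ * _ ^+ _).
      by rewrite mulrC.
    by field; rewrite natr1 pnatr_eq0.
  rewrite horner_sum big_ord_recr /= big1 ?add0r => [|k _].
    rewrite subnn expr0 mul1r !hornerE (_ : 2^-1 * (-1 - 1) = -1) //.
    by rewrite exprM sqrrN !expr1n mulr1.
  rewrite hornerZ hornerM horner_exp [x.[_]]hornerZ hornerD hornerX hornerC addNr mulr0.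
  by rewrite expr0n subn_eq0 leqNgt ltn_ord mul0r mulr0.
Qed.

Lemma horner_even (R : nzRingType) g (G : {poly R}) z :
  (size G <= (2 * g).+1)%N -> (forall i, odd i -> G`_i = 0) ->
  G.[z] = \sum_(k < g.+1) G`_(2 * k) * z ^+ (2 * k).
Proof.
move=> sG Godd; rewrite (horner_coef_wide _ sG) => {sG}.
elim: g => [|g IH]; first by rewrite !big_ord1.
rewrite mulnS add2n !(big_ord_recr (_.+2)) big_ord_recr [RHS]big_ord_recr -IH /=.
by rewrite Godd ?mul0r ?addr0 ?mulnS //= oddM.
Qed.

(** * Realization by chain pencils *)

Lemma Seifert_of_pencil (eps : rat) g n (W Z : 'M[rat]_n) (U : 'M_(g, n)) :
  eps = 1 \/ eps = -1 -> n = (g + g)%N ->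
  W^T = - eps *: W -> Z^T = eps *: Z ->
  W \in unitmx -> row_free U -> U *m W *m U^T = 0 ->
  exists2 A : 'M[rat]_n, rational_Seifert_matrix eps A &
    forall t, (Alexander_poly eps A).[t] = \det (((t + 1) / 2) *: W + ((t - 1) / 2) *: Z).
Proof.
move=> heps nE WT ZT Wu Ufree isoU.
have eps2 : eps * eps = 1 by case: heps => ->; rewrite ?mulrNN mulr1.
pose A := 2^-1 *: (W + Z).
have AT : eps *: A^T = 2^-1 *: (Z - W).
  rewrite /A linearZ linearD /= WT ZT scalerA mulrC -scalerA; congr (_ *: _).
  by rewrite scalerDr !scalerA mulrN eps2 scale1r scaleN1r addrC.
have WE : A - eps *: A^T = W by rewrite AT; apply/matrixP => i j; rewrite !mxE; field.
exists A; first by apply: Seifert_of_isotropic heps nE _ Ufree _; rewrite WE.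
move=> t; rewrite horner_Alexander_poly AT; congr (\det _).
by apply/matrixP => i j; rewrite !mxE; field.
Qed.

(** The span of the isotropic coordinates p_i and of the vector ell = u + v is
    half-dimensional and isotropic for the form W of a chain pencil. *)
Lemma Seifert_of_chain (eps : rat) n (DW DZ : 'M[rat]_(1 + n.+1)) (G : {poly rat}) :
  let ell : 'rV_(1 + n.+1) := row_mx 1%:M (delta_mx 0 0) in
  let M z : 'M_((1 + n.+1) + n) := block_mx (DW + z *: DZ)
           (- eps *: (row_mx 0 (up_mx _ n - z *: low_mx _ n))^T)
           (row_mx 0 (up_mx _ n + z *: low_mx _ n)) 0 in
  eps = 1 \/ eps = -1 -> DW^T = - eps *: DW -> DZ^T = eps *: DZ ->
  ell *m DW *m ell^T = 0 -> G`_0 != 0 -> (forall z, \det (M z) = G.[z]) ->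
  exists2 A : 'M[rat]_(2 * n.+1), rational_Seifert_matrix eps A &
    forall t, t != -1 ->
      (Alexander_poly eps A).[t] = ((t + 1) / 2) ^+ (2 * n.+1) * G.[(t - 1) / (t + 1)].
Proof.
move=> ell M heps DWT DZT isoD G0 detM.
have eps2 : eps * eps = 1 by case: heps => ->; rewrite ?mulrNN mulr1.
pose X0 : 'M[rat]_(n, 1 + n.+1) := row_mx 0 (up_mx _ n).
pose X1 : 'M[rat]_(n, 1 + n.+1) := row_mx 0 (low_mx _ n).
pose W : 'M[rat]_((1 + n.+1) + n) := block_mx DW (- eps *: X0^T) X0 0.
pose Z : 'M[rat]_((1 + n.+1) + n) := block_mx DZ (eps *: X1^T) X1 0.
have ME z : M z = W + z *: Z.
  rewrite scale_block_mx add_block_mx scaler0 addr0; congr block_mx.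
    have -> : row_mx 0 (up_mx _ n - z *: low_mx _ n) = X0 - z *: X1.
      by rewrite scale_row_mx opp_row_mx add_row_mx scaler0 subr0.
    rewrite linearB linearZ /= scalerBr; congr (_ + _).
    by rewrite scaleNr opprK !scalerA mulrC.
  by rewrite scale_row_mx add_row_mx scaler0 addr0.
have WT : W^T = - eps *: W.
  rewrite tr_block_mx trmx0 DWT scale_block_mx scaler0 linearZ /= trmxK.
  by rewrite scalerA mulrNN eps2 scale1r.
have ZT : Z^T = eps *: Z.
  rewrite tr_block_mx trmx0 DZT scale_block_mx scaler0 linearZ /= trmxK.
  by rewrite scalerA eps2 scale1r.
have Wu : W \in unitmx.
  by rewrite unitmxE unitfE -[W]addr0 -(scale0r Z) -ME detM horner_coef0.
pose U : 'M[rat]_(1 + n, (1 + n.+1) + n) := block_mx ell 0 0 1%:M.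
have ellX0 : X0 *m ell^T = 0.
  rewrite tr_row_mx mul_row_col mul0mx add0r trmx_delta.
  by apply/matrixP => i j; rewrite mul_up_mx !mxE.
have ellX0T : ell *m X0^T = 0 by rewrite -[ell]trmxK -trmx_mul ellX0 trmx0.
have Ufree : row_free U.
  apply/row_freeP; exists (block_mx (col_mx 1%:M 0) 0 0 1%:M).
  rewrite mulmx_block mul_row_col !mulmx0 !mul0mx !mulmx1 !addr0 !add0r.
  by rewrite -scalar_mx_block.
have isoU : U *m W *m U^T = 0.
  rewrite tr_block_mx !trmx0 trmx1 !mulmx_block !mulmx0 !mul0mx !mulmx1 !mul1mx.
  rewrite ?addr0 ?add0r isoD ellX0 -scalemxAr ellX0T.
  by rewrite scaler0 block_mx0.
have nE : ((1 + n.+1) + n)%N = ((1 + n) + (1 + n))%N by lia.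
have [A SA AE] := Seifert_of_pencil heps nE WT ZT Wu Ufree isoU.
have {nE} nE : ((1 + n.+1) + n)%N = (2 * n.+1)%N by lia.
rewrite -nE; exists A => // t; rewrite -subr_eq0 opprK => t1.
rewrite AE -detM ME -detZ scalerDr scalerA; congr (\det (_ + _ *: _)).
by field.
Qed.

Lemma sign_sqr (R : comNzRingType) k : (-1) ^+ k * (-1) ^+ k = 1 :> R.
Proof. by rewrite -expr2 sqrr_sign. Qed.

Lemma expr_double_succ (R : comNzRingType) (z : R) k :
  z ^+ (2 * k.+1) = z * z * (z ^+ k * z ^+ k).
Proof. by rewrite mul2n -addnn exprD !exprS mulrACA. Qed.

Lemma Alexander_poly_cayley_inj (eps : rat) n (G D : {poly rat}) (A : 'M[rat]_(2 * n.+1)) :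
  (forall t, t != -1 ->
     (Alexander_poly eps A).[t] = ((t + 1) / 2) ^+ (2 * n.+1) * G.[(t - 1) / (t + 1)]) ->
  (forall t, t != -1 -> D.[t] = ((t + 1) / 2) ^+ (2 * n.+1) * G.[(t - 1) / (t + 1)]) ->
  D = Alexander_poly eps A.
Proof.
move=> AE DE; apply: poly_eq_nat => k.
by rewrite AE ?DE // gt_eqF // (lt_le_trans (ltrN10 _)).
Qed.

(** Here W pairs u with v, and the 2 x 2 determinant of [det_chain] is
    r^2 + z (sum of c_i z^i (- z)^i z) for the diagonal entries c_i of Z on the
    chain; u has Z-square 1, which gives the factor z. *)
Lemma Seifert_realize_skew n (G : {poly rat}) (r : rat) :
  (size G <= (2 * n.+1).+1)%N -> (forall i, odd i -> G`_i = 0) ->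
  r != 0 -> G`_0 = r ^+ 2 ->
  exists2 A : 'M[rat]_(2 * n.+1), rational_Seifert_matrix 1 A &
    forall t, t != -1 ->
      (Alexander_poly 1 A).[t] = ((t + 1) / 2) ^+ (2 * n.+1) * G.[(t - 1) / (t + 1)].
Proof.
move=> sG Godd r0 Gr.
pose C : 'M[rat]_n.+1 := diag_mx (\row_k ((-1) ^+ k * G`_(2 * k.+1))).
pose DW : 'M[rat]_(1 + n.+1) := block_mx 0 (- r *: delta_mx 0 0) (r *: delta_mx 0 0) 0.
pose DZ : 'M[rat]_(1 + n.+1) := block_mx 1%:M 0 0 C.
apply: (@Seifert_of_chain 1 n DW DZ G).
- by left.
- rewrite tr_block_mx !trmx0 scaleN1r opp_block_mx !linearZ /= !trmx_delta.
  by rewrite !oppr0 !scalerN !scaleNr opprK.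
- by rewrite tr_block_mx !trmx0 trmx1 tr_diag_mx scale1r.
- rewrite tr_row_mx mul_row_block mul_row_col !mulmx0 addr0 add0r trmx1 mul1mx mulmx1.
  by rewrite trmx_delta -scalemxAr -scalemxAl !mul_delta_mx -scalerDl subrr scale0r.
- by rewrite Gr expf_neq0.
move=> z; rewrite scale_block_mx add_block_mx det_chain ?oner_eq0 // expr1n mul1r.
have -> : \sum_(j < n.+1) (- r *: delta_mx 0 0 + z *: 0 : 'rV_n.+1) 0 j * (- z) ^+ j = - r.
  rewrite big_ord_recl big1 => [|j _]; rewrite !mxE /= ?mul0r.
    by rewrite expr0; ring.
  by ring.
have -> : \sum_(i < n.+1) z ^+ i * (r *: delta_mx 0 0 + z *: 0 : 'cV_n.+1) i 0 = r.
  rewrite big_ord_recl big1 => [|j _]; rewrite !mxE /= ?mul0r.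
    by rewrite expr0; ring.
  by ring.
rewrite (horner_even _ sG Godd) [RHS]big_ord_recl muln0 expr0 mulr1 Gr.
rewrite mulNr opprK -expr2 addrC; congr (_ + _).
rewrite mulr_sumr; apply: eq_bigr => i _.
rewrite (bigD1 i) //= big1 ?addr0 => [|j ji]; rewrite !mxE; last first.
  by rewrite eq_sym (negbTE ji) mulr0n; ring.
rewrite !eqxx !mulr1n mulr1 /bump leq0n add1n add0r.
rewrite expr_double_succ (exprNn z); have s2 := sign_sqr rat i.
set s := (-1) ^+ i in s2 *; set a := z ^+ i.
by transitivity (s * s * (z * z * (a * a) * G`_(2 * i.+1))); [ring | rewrite s2; ring].
Qed.

Definition superdiag_mx (R : nzRingType) n (c : nat -> R) : 'M[R]_n.+1 :=
  \matrix_(i, j) if (j == i.+1 :> nat) then c i else 0.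

Lemma superdiag_form (R : comNzRingType) n (c a b : nat -> R) :
  \sum_(i < n.+1) \sum_(j < n.+1) a i * superdiag_mx n c i j * b j =
  \sum_(k < n) c k * (a k * b k.+1).
Proof.
rewrite big_ord_recr /= [X in _ + X]big1 ?addr0 => [|j _]; last first.
  by rewrite mxE ltn_eqF ?ltn_ord // mulr0 mul0r.
apply: eq_bigr => i _; rewrite (bigD1 (lift ord0 i)) //= big1 ?addr0 => [|j ji].
  by rewrite mxE /= eqxx mulrCA mulrA.
by rewrite mxE (negbTE (_ : _ != _)) ?mulr0 ?mul0r.
Qed.

Lemma form_skew (R : comNzRingType) n (a b : nat -> R) r z (L : 'M[R]_n.+1) :
  \sum_(i < n.+1) \sum_(j < n.+1) a i * (r *: delta_mx 0 0 + z *: (L - L^T)) i j * b j =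
  r * (a 0 * b 0) + z * (\sum_(i < n.+1) \sum_(j < n.+1) a i * L i j * b j
                         - \sum_(i < n.+1) \sum_(j < n.+1) b i * L i j * a j).
Proof.
have -> : r * (a 0 * b 0) =
    \sum_(i < n.+1) \sum_(j < n.+1) a i * (r *: delta_mx 0 0 : 'M_n.+1) i j * b j.
  rewrite big_ord_recl [X in _ + X]big1 => [|i _]; last first.
    by rewrite big1 // => j _; rewrite !mxE /= mulr0 mulr0 mul0r.
  rewrite big_ord_recl big1 => [|j _]; rewrite !mxE /= ?mulr0 ?mul0r //.
  by rewrite !addr0; ring.
rewrite [X in _ = _ + _ * (_ - X)]exchange_big -sumrB mulr_sumr -big_split /=.
apply: eq_bigr => i _; rewrite -sumrB mulr_sumr -big_split /=.
by apply: eq_bigr => j _; rewrite !mxE; ring.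
Qed.

(** Here W takes the values - r and r on u and v, so that u + v is isotropic.  In
    the 2 x 2 determinant of [det_chain] the diagonal gives
    - r (r - sum of 2 (-1)^k c_k z^(2k + 2)), whence the choice of c_k, and the
    coupling p between u and the end of the chain gives (-1)^n p^2 z^(2n + 2). *)
Lemma Seifert_realize_sym n (G : {poly rat}) (r p : rat) :
  (size G <= (2 * n.+1).+1)%N -> (forall i, odd i -> G`_i = 0) ->
  r != 0 -> G`_0 = (-1) ^+ n.+1 * r ^+ 2 -> G`_(2 * n.+1) = p ^+ 2 ->
  exists2 A : 'M[rat]_(2 * n.+1), rational_Seifert_matrix (-1) A &
    forall t, t != -1 ->
      (Alexander_poly (-1) A).[t] = ((t + 1) / 2) ^+ (2 * n.+1) * G.[(t - 1) / (t + 1)].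
Proof.
move=> sG Godd r0 Gr Gp.
pose c k := (-1) ^+ (n + k) * G`_(2 * k.+1) / (2 * r).
pose L : 'M[rat]_n.+1 := superdiag_mx n c.
pose DW : 'M[rat]_(1 + n.+1) := block_mx (- r)%:M 0 0 (r *: delta_mx 0 0).
pose DZ : 'M[rat]_(1 + n.+1) :=
  block_mx 0 (p *: delta_mx 0 ord_max) (- p *: delta_mx ord_max 0) (L - L^T).
apply: (@Seifert_of_chain (-1) n DW DZ G).
- by right.
- rewrite tr_block_mx !trmx0 opprK scale1r linearZ /= trmx_delta.
  by rewrite tr_scalar_mx.
- rewrite tr_block_mx !trmx0 scaleN1r opp_block_mx !linearZ /= !trmx_delta.
  by rewrite linearB /= trmxK oppr0 opprB !scalerN !scaleNr opprK.
- rewrite tr_row_mx mul_row_block mul_row_col !mulmx0 addr0 add0r trmx1 mul1mx mulmx1.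
  rewrite trmx_delta -scalemxAr -scalemxAl !mul_delta_mx.
  by apply/matrixP => i j; rewrite !ord1 !mxE /=; ring.
- by rewrite Gr mulf_neq0 ?signr_eq0 // expf_neq0.
move=> z; rewrite scale_block_mx add_block_mx det_chain ?oppr_eq0 ?oner_eq0 //.
have -> : \sum_(j < n.+1) (0 + z *: (p *: delta_mx 0 ord_max) : 'rV_n.+1) 0 j * (- z) ^+ j
    = z * p * (- z) ^+ n.
  rewrite big_ord_recr big1 => [|j _]; rewrite !mxE /= ?eqxx ?mulr1 ?add0r //.
  by rewrite -val_eqE /= ltn_eqF ?ltn_ord // !(mulr0, mul0r).
have -> : \sum_(i < n.+1) z ^+ i * (0 + z *: (- p *: delta_mx ord_max 0) : 'cV_n.+1) i 0
    = - (z * p * z ^+ n).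
  rewrite big_ord_recr big1 => [|j _]; rewrite !mxE /= ?eqxx ?mulr1 ?add0r //; first by ring.
  by rewrite -val_eqE /= ltn_eqF ?ltn_ord // !(mulr0, mul0r).
have -> : \sum_(i < n.+1) \sum_(j < n.+1)
    z ^+ i * (r *: delta_mx 0 0 + z *: (L - L^T)) i j * (- z) ^+ j
   = r - \sum_(k < n) 2 * (-1) ^+ k * c k * z ^+ (2 * k.+1).
  have -> : r - \sum_(k < n) 2 * (-1) ^+ k * c k * z ^+ (2 * k.+1) =
      r + z * (\sum_(k < n) c k * (z ^+ k * (- z) ^+ k.+1)
               - \sum_(k < n) c k * ((- z) ^+ k * z ^+ k.+1)).
    rewrite -sumrB mulr_sumr -sumrN; congr (_ + _); apply: eq_bigr => k _.
    by rewrite expr_double_succ !exprS (exprNn z); ring.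
  rewrite -(superdiag_form n c (fun i => z ^+ i) (fun j => (- z) ^+ j)).
  rewrite -(superdiag_form n c (fun i => (- z) ^+ i) (fun j => z ^+ j)).
  by rewrite (form_skew (fun i => z ^+ i) (fun j => (- z) ^+ j)) !expr0 !mulr1.
rewrite (horner_even _ sG Godd) [RHS]big_ord_recl [in RHS]big_ord_recr /= muln0 expr0 mulr1 Gr.
rewrite -[bump _ _]/(n.+1) Gp.
set S := \sum_(k < n) _; have sn2 := sign_sqr rat n.
have -> : \sum_(i < n) G`_(2 * bump 0 i) * z ^+ (2 * bump 0 i) = (-1) ^+ n * (r * S).
  rewrite /S !mulr_sumr; apply: eq_bigr => k _.
  rewrite /bump leq0n add1n /c exprD; have sk2 := sign_sqr rat k.
  set a := (-1) ^+ n in sn2 *; set b := (-1) ^+ k in sk2 *.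
  transitivity ((a * a) * (b * b) * (G`_(2 * k.+1) * z ^+ (2 * k.+1))).
    by rewrite sn2 sk2 !mul1r.
  by field.
have -> : ((- r)%:M + z *: 0 : 'M_1) 0 0 = - r by rewrite !mxE eqxx mulr0 addr0.
rewrite expr_double_succ (exprNn z) exprS.
set a := (-1) ^+ n in sn2 *; set b := z ^+ n.
transitivity (a * (- r * (r - S)) + a * a * (p ^+ 2 * (z * z * (b * b)))); first ring.
by rewrite sn2; ring.
Qed.

Lemma Alexander_poly_realizable (eps : rat) n (D : {poly rat}) :
  eps = 1 \/ eps = -1 -> palindromic (2 * n.+1) D -> rat_square D.[eps] ->
  eps ^+ n.+1 * D.[1] != 0 -> rat_square (eps ^+ n.+1 * D.[1]) ->
  exists A : 'M[rat]_(2 * n.+1), rational_Seifert_matrix eps A /\ D = Alexander_poly eps A.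
Proof.
move=> heps palD [p Dp] + [r Dr]; rewrite Dr expf_eq0 /= => r0.
have [G [sG Godd D1 DN1 DG]] := cayley_palindromic palD.
case: heps => epsE; rewrite epsE in Dp Dr *.
  have [|A SA AE] := Seifert_realize_skew sG Godd r0.
    by rewrite -D1 -Dr expr1n mul1r.
  by exists A; split=> //; apply: Alexander_poly_cayley_inj AE DG.
have [||A SA AE] := Seifert_realize_sym (p := p) sG Godd r0.
- by rewrite -Dr -D1 mulrA sign_sqr mul1r.
- by rewrite -DN1 Dp.
by exists A; split=> //; apply: Alexander_poly_cayley_inj AE DG.
Qed.

Theorem theorem3p22 (eps : rat) (heps : eps = 1 \/ eps = -1)
    (g : nat) (hg : (1 <= g)%N) (Delta : {poly rat}) :
  (exists A : 'M[rat]_(2 * g),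
      rational_Seifert_matrix eps A /\ Delta = Alexander_poly eps A)
  <->
  [/\ Delta%:F = subst_inv Delta * ('X%:F) ^+ (2 * g),
      rat_square Delta.[eps]
    & eps ^+ g * Delta.[1] != 0 /\ rat_square (eps ^+ g * Delta.[1])].
Proof.
split=> [[A [SA ->]]|[/palindromic_of_subst_inv palD sqe [nz sq1]]].
  exact: Alexander_poly_Seifert.
by case: g hg palD nz sq1 => // n _ palD nz sq1; exact: Alexander_poly_realizable.
Qed.
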